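(* Let $h$ and $c$ be given functions on $\mathbb{R}^d$. Let $\alpha>0$. Assume that $h$ and $c$ are even homogeneous functions of degree $0$, Lipschitz of order $\alpha$ on the sphere $S^{d-1}$, with $h$ positive. Let $\delta_0>0$. Let $f$ be a function defined on $\mathbb{R}^d$ such that, for all $\delta\in(0,\delta_0)$, $$f(\xi)=\frac{c(\xi)}{|\xi|^{h(\xi)}}+o\left(\frac{1}{|\xi|^{h(\xi)+\delta}}\right)\quad\text{when } |\xi|\to+\infty .$$ Choose $\rho\in\mathcal{S}(\mathbb{R}^{d-1})$ such that $\int_{\mathbb{R}^{d-1}}\rho(\gamma)\,d\gamma=1$. Then the Radon transform $\mathcal{R}_\rho f$ of $f$ with the window $\rho$ satisfies, for all $\delta\in(0,\delta_1)$, $$\mathcal{R}_\rho f(p)=\frac{c(\theta_0)}{|p|^{h(\theta_0)}}+o\left(\frac{1}{|p|^{h(\theta_0)+\delta}}\right)\quad\text{when } p\in\mathbb{R} \text{ and } |p|\to+\infty,$$ with $\delta_1=\min(\delta_0,\alpha)$.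
   Context: $|\cdot|$ is the Euclidean norm, $S^{d-1}$ is the unit sphere of $\mathbb{R}^d$, $\theta_0=(0,\ldots,0,1)\in S^{d-1}$, and points of $\mathbb{R}^d=\mathbb{R}^{d-1}\times\mathbb{R}$ are written $(\gamma,p)$. $\mathcal{S}(\mathbb{R}^{d-1})$ is the Schwartz class of smooth rapidly decreasing functions. The Radon transform of $f$ with the window $\rho$ (in the direction $\theta_0$) is $$\mathcal{R}_\rho f(p)=\int_{\mathbb{R}^{d-1}}f(\gamma,p)\rho(\gamma)\,d\gamma,$$ considered for $p\in\mathbb{R}$ with $|p|$ large enough. A function $g$ is homogeneous of degree $0$ if $g(\lambda\xi)=g(\xi)$ for all $\lambda>0$ and $\xi\ne0$; it is even if $g(-\xi)=g(\xi)$. It is Lipschitz of order $\alpha$ on $S^{d-1}$ if there is $L>0$ with $|g(x)-g(y)|\le L|x-y|^\alpha$ for all $x,y\in S^{d-1}$.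
   Formalization: The conclusion is stated only for δ in (0, δ₁) with δ < 2; for δ ≥ 2 (possible only if α > 2 and δ₀ > 2) it fails, e.g. d = 2, h = 2, c = 1, f = |ξ|^{-2}, Gaussian ρ, where the error is of order |p|^{-4}. *)

(* Defs.v *)
From HB Require Import structures.
From mathcomp Require Import all_boot all_order all_algebra.
From mathcomp Require Import all_classical all_reals all_analysis.

Set Implicit Arguments.
Unset Strict Implicit.
Unset Printing Implicit Defensive.

Import Order.TTheory GRing.Theory Num.Theory.
Import numFieldNormedType.Exports.

Local Open Scope classical_set_scope.
Local Open Scope ring_scope.

(* The library only puts the product sigma-algebra on tuples, and Lebesgue
   measure on R alone; both are transported here to the row vectors 'rV[R]_n,
   which carry the topology and the derivatives. *)
Fact rV_display : measure_display. Proof. exact: default_measure_display. Qed.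

Section measurable_rV.
Context (R : realType) (n : nat).

Definition rV_coord (i : 'I_n) (v : 'rV[R]_n) : measurableTypeR R := v ord0 i.

Let rV_set0 : g_sigma_preimage rV_coord set0.
Proof. exact: sigma_algebra0. Qed.

Let rV_setC A : g_sigma_preimage rV_coord A -> g_sigma_preimage rV_coord (~` A).
Proof. exact: sigma_algebraC. Qed.

Let rV_bigcup (F : (set _)^nat) : (forall i, g_sigma_preimage rV_coord (F i)) ->
  g_sigma_preimage rV_coord (\bigcup_i (F i)).
Proof. exact: sigma_algebra_bigcup. Qed.

HB.instance Definition _ := @isMeasurable.Build rV_display
  'rV[R]_n (g_sigma_preimage rV_coord) rV_set0 rV_setC rV_bigcup.

Lemma measurable_rV_coord i : measurable_fun [set: 'rV[R]_n] (rV_coord i).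
Proof.
move=> _ Y mY; rewrite setTI; apply: sub_sigma_algebra => /=.
rewrite -bigcup_seq/=; exists i => /=; first by rewrite mem_index_enum.
by exists Y => //; rewrite setTI.
Qed.

Lemma measurable_fun_rV d (T : measurableType d) (f : T -> 'rV[R]_n) :
  (forall i, measurable_fun [set: T] (rV_coord i \o f)) ->
  measurable_fun [set: T] f.
Proof.
move=> mf _ A mA; rewrite setTI.
suff : g_sigma_preimage (fun i => rV_coord i \o f) `<=` measurable.
  by rewrite g_sigma_preimage_comp; apply; exists A => //; rewrite setTI.
apply: smallest_sub; first exact: sigma_algebra_measurable.
by rewrite -bigcup_seq => B [i _ [C mC <-]]; exact: mf.
Qed.

End measurable_rV.


Section lebesgue_cons.
Context (R : realType) (n : nat).
Local Open Scope ereal_scope.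

Definition rV_cons (p : measurableTypeR R * 'rV[R]_n) : 'rV[R]_n.+1 :=
  \row_i if unlift ord0 i is Some j then p.2 ord0 j else p.1.

Definition rV_uncons (v : 'rV[R]_n.+1) : measurableTypeR R * 'rV[R]_n :=
  (v ord0 ord0, \row_j v ord0 (lift ord0 j)).

Lemma rV_consK : cancel rV_cons rV_uncons.
Proof.
move=> [x w]; rewrite /rV_uncons !mxE unlift_none; congr (_, _).
by apply/rowP => j; rewrite !mxE liftK.
Qed.

Lemma rV_unconsK : cancel rV_uncons rV_cons.
Proof.
by move=> v; apply/rowP => i; rewrite mxE; case: unliftP => [j|] -> /=;
  rewrite ?mxE.
Qed.

Lemma measurable_rV_cons : measurable_fun setT rV_cons.
Proof.
apply: measurable_fun_rV => i; case: (unliftP ord0 i) => [j|] ->.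
  rewrite (_ : _ \o _ = @rV_coord R n j \o snd).
    by apply: measurableT_comp => //; exact: measurable_rV_coord.
  by apply/funext => p /=; rewrite /rV_coord mxE liftK.
rewrite (_ : _ \o _ = fst) //.
by apply/funext => p /=; rewrite /rV_coord mxE unlift_none.
Qed.

Lemma measurable_rV_uncons : measurable_fun setT rV_uncons.
Proof.
apply/measurable_fun_pair; first exact: (measurable_rV_coord ord0).
apply: measurable_fun_rV => j.
rewrite (_ : _ \o _ = @rV_coord R n.+1 (lift ord0 j)).
  exact: measurable_rV_coord.
by apply/funext => v; rewrite /rV_coord /= mxE.
Qed.

Variable m : {sigma_finite_measure set 'rV[R]_n -> \bar R}.

Definition lebesgue_cons : set 'rV[R]_n.+1 -> \bar R :=
  pushforward (@lebesgue_measure R \x m) rV_cons.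

Let lebesgue_cons0 : lebesgue_cons set0 = 0.
Proof. by rewrite /lebesgue_cons /pushforward preimage_set0 measure0. Qed.

Let lebesgue_cons_ge0 A : 0 <= lebesgue_cons A.
Proof. exact: (@measure_ge0 _ _ _ (@lebesgue_measure R \x m)). Qed.

Let lebesgue_cons_sigma_additive : semi_sigma_additive lebesgue_cons.
Proof.
have mcons A : measurable A -> measurable (rV_cons @^-1` A).
  by move=> mA; rewrite -[_ @^-1` _]setTI; exact: measurable_rV_cons.
move=> F mF tF mUF; rewrite /lebesgue_cons /pushforward preimage_bigcup.
apply: measure_semi_sigma_additive.
- by move=> k; exact: mcons.
- apply/trivIsetP => /= i j _ _ ij; rewrite -preimage_setI.
  by move/trivIsetP : tF => /(_ _ _ _ _ ij) ->//; rewrite preimage_set0.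
- by rewrite -preimage_bigcup; exact: mcons.
Qed.

HB.instance Definition _ := isMeasure.Build _ _ _ lebesgue_cons
  lebesgue_cons0 lebesgue_cons_ge0 lebesgue_cons_sigma_additive.

Let lebesgue_cons_sigma_finite : sigma_finite setT lebesgue_cons.
Proof.
have /sigma_finiteP[F [TF ndF Foo]] := sigma_finiteT (@lebesgue_measure R).
have /sigma_finiteP[G [TG ndG Goo]] := sigma_finiteT m.
exists (fun k => rV_uncons @^-1` (F k `*` G k)).
  rewrite -preimage_bigcup -[LHS](preimage_setT rV_uncons); congr (_ @^-1` _).
  rewrite -setXTT TF TG predeqE => -[x y]; split.
    move=> [/= [i _ Fix] [k _ Gky]]; exists (maxn i k) => //; split.
    - by move: x Fix; exact/subsetPset/ndF/leq_maxl.
    - by move: y Gky; exact/subsetPset/ndG/leq_maxr.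
  by move=> [i _ []/= ? ?]; split; exists i.
move=> k; have [mF Fk] := Foo k; have [mG Gk] := Goo k; split.
  rewrite -[_ @^-1` _]setTI; apply: measurable_rV_uncons => //.
  exact: measurableX.
rewrite /lebesgue_cons /pushforward -comp_preimage.
rewrite (_ : rV_uncons \o rV_cons = id); last exact/funext/rV_consK.
by rewrite preimage_id product_measure1E// lte_mul_pinfty// ge0_fin_numE.
Qed.

HB.instance Definition _ := Measure_isSigmaFinite.Build _ _ _ lebesgue_cons
  lebesgue_cons_sigma_finite.

End lebesgue_cons.

(* n-dimensional Lebesgue measure: an n-fold product, with the unit mass for
   n = 0. *)
Fixpoint lebesgue_rV (R : realType) (n : nat) :
    {sigma_finite_measure set 'rV[R]_n -> \bar R} :=
  match n with
  | 0 => \d_(0 : 'rV[R]_0)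
  | n'.+1 => lebesgue_cons (lebesgue_rV R n')
  end.

Lemma lebesgue_rV_box (R : realType) (n : nat)
    (A : 'I_n -> set (measurableTypeR R)) :
  (forall i, measurable (A i)) ->
  lebesgue_rV R n [set v | forall i, A i (v ord0 i)] =
  (\prod_(i < n) lebesgue_measure (A i))%E.
Proof.
elim: n A => [|n IH] A mA.
  by rewrite big_ord0 /= diracE mem_set // => -[].
rewrite big_ord_recl -(IH (fun i => A (lift ord0 i))) //=.
rewrite /lebesgue_cons /pushforward.
rewrite (_ : _ @^-1` _ = A ord0 `*`
    [set v : 'rV[R]_n | forall i, A (lift ord0 i) (v ord0 i)]).
  rewrite product_measure1E //.
  rewrite (_ : [set _ | _] = \bigcap_(i in [set: 'I_n])
     (@rV_coord R n i @^-1` A (lift ord0 i))).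
    apply: fin_bigcap_measurable => [|i _]; first exact: finite_finset.
    by rewrite -[_ @^-1` _]setTI; exact: measurable_rV_coord.
  by apply/seteqP; split => v /= H i *; exact: H.
apply/seteqP; split => -[x w] /=.
  move=> H; split => [|i] /=; first by have := H ord0; rewrite mxE unlift_none.
  by have := H (lift ord0 i); rewrite mxE liftK.
by move=> [/= H0 H1] i; rewrite mxE; case: unliftP => [j|] -> //=.
Qed.

(* The norm `|v| of 'rV[R]_n in the library is the sup norm. *)
Definition enorm (R : realType) (n : nat) (v : 'rV[R]_n) : R :=
  Num.sqrt (\sum_i v ord0 i ^+ 2).

Definition sphere (R : realType) (d : nat) : set 'rV[R]_d :=
  [set x | enorm x = 1].

Definition theta0 (R : realType) (n : nat) : 'rV[R]_(n + 1) :=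
  row_mx 0 (const_mx 1).
Arguments theta0 {R n}.

Definition point (R : realType) (n : nat) (gamma : 'rV[R]_n) (p : R) :
  'rV[R]_(n + 1) := row_mx gamma (const_mx p).

(* The filter "N x -> +oo" on T. *)
Definition at_infty (R : realType) (T : Type) (N : T -> R) : set_system T :=
  filter_from [set: R] (fun M => [set x | M < N x]).

Global Instance at_infty_filter (R : realType) (T : Type) (N : T -> R) :
  Filter (at_infty N).
Proof.
apply: filter_from_filter; first by exists 0.
move=> M1 M2 _ _; exists (Num.max M1 M2) => // x /=.
by rewrite gt_max => /andP[].
Qed.

Canonical at_infty_filter_on (R : realType) (T : Type) (N : T -> R) :=
  FilterType (at_infty N) (at_infty_filter N).

Section function_classes.
Context (R : realType) (n : nat).
Implicit Types g : 'rV[R]_n -> R.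

Definition homogeneous0 g :=
  forall (lambda : R) (x : 'rV[R]_n), 0 < lambda -> x != 0 ->
    g (lambda *: x) = g x.

Definition even_fun g := forall x, g (- x) = g x.

Definition lipschitz_sphere (alpha : R) g :=
  exists2 L : R, 0 < L & forall x y, sphere x -> sphere y ->
    `|g x - g y| <= L * enorm (x - y) `^ alpha.

Definition partial (i : 'I_n) (g : 'rV[R]_n -> R^o) : 'rV[R]_n -> R^o :=
  fun x => 'D_(delta_mx ord0 i) g x.

(* [:: i1; ..; ik] indexes the derivative d_i1 (.. (d_ik g)). *)
Definition partials (s : seq 'I_n) g : 'rV[R]_n -> R^o := foldr partial g s.

Definition smooth g := forall s : seq 'I_n,
  continuous (partials s g) /\
  forall (i : 'I_n) x, derivable (partials s g) x (delta_mx ord0 i).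

Definition schwartz g := smooth g /\
  forall (s : seq 'I_n) (k : nat), exists C : R, forall x,
    (1 + enorm x) ^+ k * `|partials s g x| <= C.

(* Applying this to a function f that need not be measurable is harmless:
   the integral is then the difference of the lower integrals of the positive
   and negative parts of the integrand, which agrees with the Lebesgue
   integral whenever the integrand is Lebesgue measurable. *)
Definition radon (rho : 'rV[R]_n -> R) (f : 'rV[R]_(n + 1) -> R) (p : R) : R :=
  \int[lebesgue_rV R n]_(gamma in setT) (f (point gamma p) * rho gamma).

Definition radon_defined (rho : 'rV[R]_n -> R) (f : 'rV[R]_(n + 1) -> R)
    (p : R) : Prop :=
  (\int[lebesgue_rV R n]_(gamma in setT)
     (`|f (point gamma p) * rho gamma|%:E) < +oo)%E.

End function_classes.

(* Main.v *)
(* Write t = |gamma|, xi = (gamma, p), r = |xi|, H = h(theta0), and fix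
   delta < delta' < min(delta0, alpha, 2). The unit vector xi / r is within
   t / |p| of theta0 (up to sign, which evenness absorbs), so h(xi) and c(xi)
   are within O((t / |p|)^alpha) of their values at theta0. For t^2 <= |p| this
   gives f(xi) = c(theta0) |p|^-H + O((1 + t)^M |p|^-(H + delta')), the
   replacement of r by |p| costing a relative error t^2 / p^2 (hence
   delta < 2). For t^2 > |p| everything is bounded and (1 + t)^M beats any power
   of |p|. Multiplying by rho and integrating gives the claim, since rho decays
   faster than any polynomial. Since f need not be measurable, f rho is
   compared directly with the measurable c(theta0) |p|^-H rho. *)
Require Import Defs.
From HB Require Import structures.
From mathcomp Require Import all_boot all_order all_algebra.
From mathcomp Require Import all_classical all_reals all_analysis.
From mathcomp Require Import measurable_realfun.
From mathcomp Require Import ring lra.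

Set Implicit Arguments.
Unset Strict Implicit.
Unset Printing Implicit Defensive.

Import Order.TTheory GRing.Theory Num.Theory.
Import numFieldNormedType.Exports.

Local Open Scope classical_set_scope.
Local Open Scope ring_scope.

(* [point] is shadowed by the base point of a pointed type. *)
Local Notation point := Defs.point.

(** * Lebesgue measure on row vectors *)

(** An open set is the union of the boxes with rational centre and radius that it contains. There
    are countably many, each a finite intersection of coordinate preimages of intervals. *)
Lemma open_measurable_rV (R : realType) (n : nat) (U : set 'rV[R]_n) :
  open U -> measurable U.
Proof.
move=> oU.
pose box (q : 'rV[rat]_n * rat) : set 'rV[R]_n :=
  [set v | forall i, `|ratr (q.1 ord0 i) - v ord0 i| < ratr q.2].
have -> : U = \bigcup_(q in [set q | box q `<=` U]) box q.
  apply/seteqP; split => [x Ux|x [q /= qU xq]]; last exact: qU.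
  have /nbhs_ballP[e /= e0 xeU] : nbhs x U by exact: open_nbhs_nbhs.
  have [r /andP[r0 re]] : exists r : rat, 0 < (ratr r : R) < e / 2.
    have [r] := @rat_in_itvoo R 0 (e / 2) (divr_gt0 e0 (ltr0Sn _ _)).
    by rewrite in_itv/= => ?; exists r.
  (* A rational centre within [r] < e / 2 of [x] in each coordinate keeps the whole box inside the
     ball of radius [e]. *)
  have /choice[q qP] : forall i, exists q : rat, `|ratr q - x ord0 i| < ratr r.
    move=> i; have [|q] := @rat_in_itvoo R (x ord0 i - ratr r) (x ord0 i + ratr r).
      by rewrite ltrD2l (lt_trans _ r0)// oppr_lt0.
    by rewrite in_itv/= => xq; exists q; rewrite ltr_distl.
  exists (\row_i q i, r) => /=; last by move=> i /=; rewrite mxE.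
  move=> v /= qv; apply: xeU; split=> // i j /=; rewrite (ord1 i) /ball/=.
  have := qv j; have := qP j; rewrite /= mxE => xq vq.
  rewrite -(subrK (ratr (q j)) (x ord0 j)) -addrA (le_lt_trans (ler_normD _ _))//.
  by rewrite (splitr e) ltrD//; [rewrite distrC (lt_trans xq)|rewrite (lt_trans vq)].
rewrite bigcup_mkcond; apply: countable_bigcupT_measurable => // q.
case: ifP => // _; rewrite (_ : box q = \bigcap_(i in [set: 'I_n])
    (@rV_coord R n i @^-1` [set y | `|ratr (q.1 ord0 i) - y| < ratr q.2])).
  apply: fin_bigcap_measurable => [|i _]; first exact: finite_finset.
  rewrite -[_ @^-1` _]setTI; apply: measurable_rV_coord => //.
  set a := ratr _; rewrite (_ : [set y | _] = `]a - ratr q.2, a + ratr q.2[%classic).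
    exact: measurable_itv.
  by apply/seteqP; split => y /=; rewrite in_itv/= ltr_distlC.
by apply/seteqP; split => v /= H i *; exact: H.
Qed.

Lemma continuous_measurable_rV (R : realType) (n : nat) (g : 'rV[R]_n -> R) :
  continuous g -> measurable_fun [set: 'rV[R]_n] g.
Proof.
move=> cg; apply: (measurability _ (RGenOpens.measurableE R)).
move=> _ [_ [a [b ->] <-]]; rewrite setTI; apply: open_measurable_rV.
by apply: open_comp; [move=> x _; exact: cg|exact: interval_open].
Qed.

(** By evenness, this is twice the half-line integral pi / 2. *)
Lemma integral_oneDsqrV (R : realType) :
  (\int[@lebesgue_measure R]_x ((oneDsqr x)^-1)%:E = (pi : R)%:E)%E.
Proof.
rewrite ge0_symfun_integralT.
- rewrite -set_itvcy integral0y_oneDsqr -EFinM mulrC divfK//.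
- by move=> x; rewrite invr_ge0 addr_ge0// sqr_ge0.
- exact: continuous_oneDsqrV.
- by move=> x /=; rewrite /oneDsqr sqrrN.
Qed.

Lemma integral_lebesgue_cons (R : realType) (n : nat)
    (m : {sigma_finite_measure set 'rV[R]_n -> \bar R}) (g : 'rV[R]_n.+1 -> R) :
  measurable_fun [set: 'rV[R]_n.+1] g -> (forall v, 0 <= g v) ->
  (\int[lebesgue_cons m]_v (g v)%:E =
   \int[@lebesgue_measure R]_x \int[m]_w (g (rV_cons (x, w)))%:E)%E.
Proof.
move=> mg g0.
rewrite /lebesgue_cons (ge0_integral_pushforward (@measurable_rV_cons R n))//.
  rewrite preimage_setT fubini_tonelli1//=.
    apply/measurable_EFinP; apply: measurableT_comp => //.
    exact: measurable_rV_cons.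
  by move=> x; rewrite lee_fin.
  exact/measurable_EFinP.
by move=> v _; rewrite lee_fin.
Qed.

Lemma measurable_oneDsqrV (R : realType) :
  measurable_fun [set: measurableTypeR R] (fun x : R => (oneDsqr x)^-1).
Proof. by apply: continuous_measurable_fun; exact: continuous_oneDsqrV. Qed.

Lemma measurable_prod_oneDsqrV (R : realType) (n : nat) :
  measurable_fun [set: 'rV[R]_n] (fun v => \prod_i (oneDsqr (v ord0 i))^-1).
Proof.
apply: measurable_prod => i _.
apply: (@measurableT_comp _ _ _ _ _ _ (fun x : R => (oneDsqr x)^-1)).
  exact: measurable_oneDsqrV.
exact: measurable_rV_coord.
Qed.

Lemma oneDsqrV_ge0 (R : realType) (x : R) : 0 <= (oneDsqr x)^-1.
Proof. by rewrite invr_ge0 addr_ge0// sqr_ge0. Qed.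

Lemma prod_oneDsqrV_ge0 (R : realType) (n : nat) (v : 'rV[R]_n) :
  0 <= \prod_i (oneDsqr (v ord0 i))^-1.
Proof. by apply: prodr_ge0 => i _; exact: oneDsqrV_ge0. Qed.

(** This product serves as the integrable dominating function for the rapidly decreasing window.
    Tonelli splits off one coordinate at a time, each contributing a factor pi. *)
Lemma integral_prod_oneDsqrV (R : realType) (n : nat) :
  (\int[lebesgue_rV R n]_v (\prod_i (oneDsqr (v ord0 i))^-1)%:E =
   ((pi : R) ^+ n)%:E)%E.
Proof.
elim: n => [|n IH].
  rewrite integral_dirac//=.
    by rewrite diracT mul1e big_ord0.
  by apply/measurable_EFinP; exact: measurable_prod_oneDsqrV.
etransitivity; first apply: integral_lebesgue_cons.
- exact: measurable_prod_oneDsqrV.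
- exact: prod_oneDsqrV_ge0.
transitivity (\int[@lebesgue_measure R]_x (((oneDsqr x)^-1)%:E * (pi ^+ n)%:E))%E.
  apply: eq_integral => x _; rewrite -IH -ge0_integralZl//.
  - apply: eq_integral => w _; rewrite big_ord_recl mxE unlift_none/= EFinM.
    by congr (_ * _%:E)%E; apply: eq_bigr => i _; rewrite mxE liftK.
  - by apply/measurable_EFinP; exact: measurable_prod_oneDsqrV.
  - by move=> w _; exact: prod_oneDsqrV_ge0.
rewrite ge0_integralZr//.
- by rewrite integral_oneDsqrV -EFinM exprS.
- by apply/measurable_EFinP; exact: measurable_oneDsqrV.
- by apply: exprn_ge0; exact: pi_ge0.
Qed.

Lemma integrable_prod_oneDsqrV (R : realType) (n : nat) (C : R) :
  (lebesgue_rV R n).-integrable setT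
    (EFin \o (fun v : 'rV[R]_n => C * \prod_i (oneDsqr (v ord0 i))^-1)).
Proof.
apply: (@eq_integrable _ _ _ _ _ measurableT
  (fun v : 'rV[R]_n => C%:E * (\prod_i (oneDsqr (v ord0 i))^-1)%:E)%E) => //.
apply: integrableZl => //; apply/integrableP; split.
  by apply/measurable_EFinP; exact: measurable_prod_oneDsqrV.
under eq_integral do rewrite gee0_abs ?lee_fin ?prod_oneDsqrV_ge0//.
by rewrite integral_prod_oneDsqrV ltry.
Qed.

(** * Integrals of functions that need not be measurable *)

(** The integral of a nonnegative function is a supremum over the simple functions below it, so
    monotonicity holds without measurability. *)
Lemma le_ge0_integralT d (T : measurableType d) (R : realType)
    (mu : {measure set T -> \bar R}) (f g : T -> \bar R) :
  (forall x, 0 <= f x)%E -> (forall x, f x <= g x)%E ->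
  (\int[mu]_x f x <= \int[mu]_x g x)%E.
Proof.
move=> f0 fg; have g0 x : (0 <= g x)%E by exact: le_trans (fg x).
rewrite !ge0_integralTE//; apply: ereal_sup_le => _ [k /= kf <-].
by exists k => //= x; exact: le_trans (fg x).
Qed.

(* Only [v] and [G] are measurable, so additivity fails for [u + G]; the second
   inequality compares [u] with the measurable minorant [max (v - G) 0]. *)
Lemma le_addr_ge0_integral d (T : measurableType d) (R : realType)
    (mu : {measure set T -> \bar R}) (u v G : T -> R) :
  (forall x, 0 <= u x) -> (forall x, 0 <= v x) -> (forall x, 0 <= G x) ->
  measurable_fun setT v -> measurable_fun setT G ->
  (forall x, `|u x - v x| <= G x) ->
  (\int[mu]_x (u x)%:E <= \int[mu]_x (v x)%:E + \int[mu]_x (G x)%:E)%E /\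
  (\int[mu]_x (v x)%:E <= \int[mu]_x (u x)%:E + \int[mu]_x (G x)%:E)%E.
Proof.
move=> u0 v0 G0 mv mG uvG; split.
  rewrite -ge0_integralD//; [|by move=> x _; rewrite lee_fin|exact/measurable_EFinP|
    by move=> x _; rewrite lee_fin|exact/measurable_EFinP].
  apply: le_ge0_integralT => x; rewrite ?lee_fin// -lerBlDl.
  exact: le_trans (ler_norm _) (uvG x).
pose w x := Num.max (v x - G x) 0.
have mw : measurable_fun setT w
  by apply: measurable_maxr => //; exact: measurable_funB.
have w0 x : 0 <= w x by rewrite le_max lexx orbT.
apply: (@le_trans _ _ (\int[mu]_x (w x)%:E + \int[mu]_x (G x)%:E)%E).
  rewrite -ge0_integralD//; [|by move=> x _; rewrite lee_fin|exact/measurable_EFinP|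
    by move=> x _; rewrite lee_fin|exact/measurable_EFinP].
  apply: le_ge0_integralT => x; rewrite ?lee_fin// -lerBlDr.
  by rewrite le_max lexx.
apply: leeD => //; apply: le_ge0_integralT => x; rewrite lee_fin//.
rewrite /w ge_max u0 andbT lerBlDl -lerBlDr.
by rewrite (le_trans (ler_norm _))// distrC.
Qed.

(** The positive and negative parts of [u] are compared separately with those of [v]; the two
    comparisons account for the factor 2. *)
Lemma Rintegral_dist_le d (T : measurableType d) (R : realType)
    (mu : {measure set T -> \bar R}) (u v G : T -> R) :
  mu.-integrable setT (EFin \o v) -> mu.-integrable setT (EFin \o G) ->
  (forall x, `|u x - v x| <= G x) ->
  (\int[mu]_x (`|u x|%:E) < +oo)%E /\
  `|\int[mu]_x u x - \int[mu]_x v x| <= 2 * \int[mu]_x G x.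
Proof.
move=> iv iG uvG; have G0 x : 0 <= G x by exact: le_trans (uvG x).
have mv : measurable_fun setT v by apply/measurable_EFinP; exact: measurable_int iv.
have mG : measurable_fun setT G by apply/measurable_EFinP; exact: measurable_int iG.
(* Used three times: for the absolute values, which gives finiteness, then for the positive parts
   and for the negative parts. *)
have fin_part (w w' : T -> R) : (forall x, 0 <= w x) -> (forall x, 0 <= w' x) ->
    measurable_fun setT w' ->
    (forall x, `|w' x| <= `|v x|) -> (forall x, `|w x - w' x| <= G x) ->
    exists a b : R, [/\ (\int[mu]_x (w x)%:E = a%:E)%E,
      (\int[mu]_x (w' x)%:E = b%:E)%E & `|a - b| <= \int[mu]_x G x].
  move=> w0 w'0 mw' w'v ww'.
  have [l1 l2] := le_addr_ge0_integral mu w0 w'0 G0 mw' mG ww'.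
  have fG : (\int[mu]_x (G x)%:E)%E = (\int[mu]_x G x)%:E.
    by rewrite /Rintegral fineK// integrable_fin_num.
  have /integrable_fin_num fw' : mu.-integrable setT (EFin \o w').
    apply: le_integrable iv => //; first exact/measurable_EFinP.
    by move=> x _; rewrite lee_fin.
  have {}fw' := fw' measurableT.
  have fw : (\int[mu]_x (w x)%:E)%E \is a fin_num.
    rewrite ge0_fin_numE; last by apply: integral_ge0 => x _; rewrite lee_fin.
    by rewrite (le_lt_trans l1)// -(fineK fw') fG -EFinD ltry.
  exists (fine (\int[mu]_x (w x)%:E)), (fine (\int[mu]_x (w' x)%:E)).
  rewrite !fineK//; split=> //; move: l1 l2; rewrite -(fineK fw) -(fineK fw') fG.
  by rewrite -!EFinD !lee_fin/= ler_distl => l1 l2; rewrite lerBlDr l1 l2.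
split.
  have [||||x|a [b [-> _ _]]] := fin_part (fun x => `|u x|) (fun x => `|v x|);
    rewrite ?ltry//.
  - exact: measurableT_comp.
  - by move=> x; rewrite normr_id.
  - by rewrite (le_trans (ler_dist_dist _ _)).
pose pos (w : T -> R) x := Num.max (w x) 0.
pose neg (w : T -> R) x := Num.max (- w x) 0.
have intE (w : T -> R) : (\int[mu]_x (w x)%:E =
    \int[mu]_x (pos w x)%:E - \int[mu]_x (neg w x)%:E)%E.
  by rewrite integralE; congr (_ - _)%E; apply: eq_integral => x _;
    rewrite /pos /neg ?funeposE ?funenegE -?EFinN EFin_max.
(* Truncation at 0 is 1-Lipschitz, so the bound [G] passes to both parts. *)
have dist_max (a b : R) : `|Num.max a 0 - Num.max b 0| <= `|a - b|.
  have := ler_norm (a - b); have := ler_norm (b - a); rewrite distrC.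
  rewrite ler_norml /Order.max.
  by case: (ltP a 0) => ?; case: (ltP b 0) => ? ? ?; apply/andP; split; lra.
have [||||x|a [b [ua vb ab]]] := fin_part (pos u) (pos v).
- by move=> x; rewrite le_max lexx orbT.
- by move=> x; rewrite le_max lexx orbT.
- exact: measurable_maxr.
- move=> x; have := dist_max (v x) 0; by rewrite maxxx !subr0.
- exact: le_trans (dist_max _ _) _.
have [||||x|a' [b' [ua' vb' ab']]] := fin_part (neg u) (neg v).
- by move=> x; rewrite le_max lexx orbT.
- by move=> x; rewrite le_max lexx orbT.
- by apply: measurable_maxr => //; exact: measurableT_comp.
- move=> x; have := dist_max (- v x) 0; by rewrite maxxx !subr0 normrN.
- by rewrite (le_trans (dist_max _ _))// -opprD normrN.
rewrite [X in X - _]/Rintegral [X in _ - X]/Rintegral.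
rewrite (intE u) (intE v) ua vb ua' vb' -!EFinB/=.
have -> : a - a' - (b - b') = (a - b) - (a' - b') by ring.
by rewrite (le_trans (ler_normB _ _))// mulr_natl mulr2n lerD.
Qed.

(** * The pointwise expansion *)

(** For x >= 0, multiply 1 - x <= exp(- x) by exp x. For x < 0, combine 1 - exp x <= - x with exp(-
    x) >= 1. *)
Lemma ler_dist_expR1 (R : realType) (x : R) : `|expR x - 1| <= `|x| * expR `|x|.
Proof.
have [x0|x0] := leP 0 x.
  rewrite ger0_norm ?(ger0_norm x0); last by rewrite subr_ge0 -expR0 ler_expR.
  have := expR_ge1Dx (- x); have := expRxMexpNx_1 x; have := expR_gt0 x.
  by set e := expR x; set e' := expR (- x); nra.
rewrite ltr0_norm ?(ltr0_norm x0); last by rewrite subr_lt0 expR_lt1.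
have := expR_ge1Dx x; have : 1 <= expR (- x) by rewrite -expR0 ler_expR; lra.
by move: (expR x) (expR (- x)) => e e'; nra.
Qed.

(** This is ln z < z at z = x^a. *)
Lemma ln_le_powR (R : realType) (a x : R) : 0 < a -> 0 < x -> ln x <= x `^ a / a.
Proof.
move=> a0 x0; rewrite ler_pdivlMr// mulrC -ln_powR.
by rewrite ltW// ln_sublinear// powR_gt0.
Qed.

Lemma powR_le_exp1D (R : realType) (a t : R) (m : nat) :
  0 <= t -> a <= m%:R -> 0 <= a -> t `^ a <= (1 + t) ^+ m.
Proof.
move=> t0 am a0; have t1 : 1 <= 1 + t by lra.
apply: (@le_trans _ _ ((1 + t) `^ a)).
  by rewrite ge0_ler_powR ?nnegrE//; lra.
by rewrite -powR_mulrn ?ler_powR//; lra.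
Qed.

Section pointwise.
Variables (R : realType) (H C Lh Lc alpha d : R) (m : nat).
Hypotheses (H0 : 0 < H) (Lh0 : 0 < Lh) (Lc0 : 0 < Lc) (a0 : 0 < alpha)
  (d0 : 0 < d) (da : d < alpha) (d2 : d <= 2)
  (am : alpha <= m%:R) (Hm : H + d <= m%:R).
(** Data at a single point xi: [hx], [cx], [fx] are the values of h, c, f there, and [p] stands for
    |p|. With plain real numbers, the constants are visibly independent of the point. *)
Variables (hx cx fx t p r : R).
Hypotheses (p2 : 2 <= p) (t0 : 0 <= t) (r0 : 0 < r)
  (rE : r ^+ 2 = t ^+ 2 + p ^+ 2) (hx0 : 0 < hx)
  (hH : `|hx - H| <= Lh * (t / p) `^ alpha)
  (cC : `|cx - C| <= Lc * (t / p) `^ alpha)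
  (fc : `|fx - cx * r `^ (- hx)| <= r `^ (- (hx + d))).

Let p0 : 0 < p. Proof. exact: lt_le_trans p2. Qed.
Let p1 : 1 <= p. Proof. by apply: le_trans p2; rewrite ler1n. Qed.
Let pr : p <= r.
Proof.
by rewrite -(@ler_pXn2r _ 2) ?nnegrE ?(ltW p0) ?(ltW r0)// rE lerDr sqr_ge0.
Qed.
Let r1 : 1 <= r. Proof. exact: le_trans pr. Qed.

Let powRN_le1 (b s : R) : 1 <= b -> 0 <= s -> b `^ (- s) <= 1.
Proof. by move=> b1 s0; rewrite -(powRr0 b) ler_powR// oppr_le0. Qed.

Let tp_le : (t / p) `^ alpha <= (1 + t) ^+ m * p `^ (- alpha).
Proof.
rewrite powRM// ?invr_ge0 ?(ltW p0)// -powR_inv1 ?(ltW p0)// -powRrM mulN1r.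
by rewrite ler_wpM2r ?powR_ge0// powR_le_exp1D// ltW.
Qed.

Let T1 : 1 <= (1 + t) ^+ m.
Proof. by rewrite exprn_ege1// lerDl. Qed.

Lemma far_bound : p < t ^+ 2 ->
  `|fx - C * p `^ (- H)| <=
    (2 * `|C| + Lc + 1) * (1 + t) ^+ (3 * m) * p `^ (- (H + d)).
Proof.
move=> pt.
have cx_le : `|cx| <= `|C| + Lc * (1 + t) ^+ m.
  rewrite -(subrK C cx) (le_trans (ler_normD _ _))// addrC lerD2l.
  apply: (le_trans cC); rewrite ler_pM2l//; apply: (le_trans tp_le).
  by rewrite ler_piMr ?powRN_le1 ?(ltW a0)// exprn_ge0// addr_ge0.
have rh1 : r `^ (- hx) <= 1 by rewrite powRN_le1// ltW.
have rhd1 : r `^ (- (hx + d)) <= 1 by rewrite powRN_le1// addr_ge0// ltW.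
have pH1 : p `^ (- H) <= 1 by rewrite powRN_le1// ltW.
have step : `|fx - C * p `^ (- H)| <= (2 * `|C| + Lc + 1) * (1 + t) ^+ m.
  have -> : fx - C * p `^ (- H) =
      (fx - cx * r `^ (- hx)) + cx * r `^ (- hx) - C * p `^ (- H) by ring.
  have e1 := ler_normB (fx - cx * r `^ (- hx) + cx * r `^ (- hx)) (C * p `^ (- H)).
  have e2 := ler_normD (fx - cx * r `^ (- hx)) (cx * r `^ (- hx)).
  have e3 : `|cx * r `^ (- hx)| <= `|cx|.
    by rewrite normrM (ger0_norm (powR_ge0 _ _)) ler_piMr.
  have e4 : `|C * p `^ (- H)| <= `|C|.
    by rewrite normrM (ger0_norm (powR_ge0 _ _)) ler_piMr.
  have C0 := normr_ge0 C.
  by move: T1 fc e1 e2 e3 e4 C0 cx_le rhd1; nra.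
apply: (le_trans step); rewrite -mulrA ler_wpM2l//.
  by rewrite !addr_ge0 ?mulr_ge0 ?(ltW Lc0).
rewrite powRN ler_pdivlMr ?powR_gt0// (_ : (3 * m)%N = (m + 2 * m)%N); last first.
  by rewrite mulSn.
rewrite exprD ler_wpM2l ?(le_trans ler01)// exprM.
apply: (@le_trans _ _ (p ^+ m)); first by rewrite -powR_mulrn ?ler_powR// ltW.
have pt1 : p <= (1 + t) ^+ 2 .
  by rewrite (le_trans (ltW pt))// lerXn2r ?nnegrE ?lerDr ?addr_ge0.
by rewrite lerXn2r ?nnegrE ?sqr_ge0 ?(ltW p0).
Qed.

(* Since |hx - H| <= Lh p^(- alpha / 2) and ln r <= 2 ln p <= 4 / alpha *
   p^(alpha / 2), the exponent [y] in r^(- hx) = r^(- H) e^(- y) is bounded. *)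
Let B := Lh * (4 / alpha).
Let y := (hx - H) * ln r.

Let lnr_ge0 : 0 <= ln r. Proof. exact: ln_ge0. Qed.

(** Since p >= 2, r^2 = t^2 + p^2 <= 2 p^2 <= p^4, that is r <= p^2. *)
Let lnr_le : t ^+ 2 <= p -> ln r <= 2 * ln p.
Proof.
move=> tp; rewrite mulrC mulr_natr -lnXn// ler_ln ?posrE ?exprn_gt0//.
rewrite -(@ler_pXn2r _ 2) ?nnegrE ?exprn_ge0 ?(ltW p0) ?(ltW r0)// rE.
have q2 : 2 * p <= p ^+ 2 by rewrite expr2 ler_pM2r.
have q4 : 2 * p ^+ 2 <= (p ^+ 2) ^+ 2.
  by rewrite [leRHS]expr2 ler_pM2r ?exprn_gt0// (le_trans _ q2)// ler_peMr.
rewrite (le_trans _ q4)// mulr_natl mulr2n lerD2r (le_trans tp)//.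
by rewrite (le_trans _ q2)// ler_peMl ?ler1n// ltW.
Qed.

Let y_leB : t ^+ 2 <= p -> `|y| <= B.
Proof.
move=> tp; rewrite /y normrM (ger0_norm lnr_ge0).
apply: (@le_trans _ _ (Lh * (p `^ (- (alpha / 2))) *
    (2 * (p `^ (alpha / 2) / (alpha / 2))))).
  apply: ler_pM => //; last first.
    by rewrite (le_trans (lnr_le tp))// ler_wpM2l// ln_le_powR// divr_gt0.
  apply: (le_trans hH); rewrite ler_pM2l//.
  (* From t <= sqrt p comes t / p <= p^(- 1/2), to be raised to the power [alpha]. *)
  have -> : p `^ (- (alpha / 2)) = (p `^ (- 2^-1)) `^ alpha.
    by rewrite -powRrM mulNr mulrC.
  rewrite ge0_ler_powR ?nnegrE ?powR_ge0 ?divr_ge0 ?(ltW p0) ?(ltW a0)//.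
  rewrite powRN powR12_sqrt ?(ltW p0)// ler_pdivrMr//.
  have : Num.sqrt p ^+ 2 = p by rewrite sqr_sqrtr// ltW.
  have s0 : 0 < Num.sqrt p by rewrite sqrtr_gt0.
  move=> sE; rewrite mulrC ler_pdivlMr//.
  by rewrite -{2}sE expr2 ler_pM2r//; nra.
rewrite powRN /B le_eqVlt; apply/orP; left; apply/eqP.
by field; rewrite gt_eqF// gt_eqF ?powR_gt0.
Qed.

Let K1 := Lh * 2 / (alpha - d).

(** The logarithm is now bounded with the exponent alpha - d > 0: it consumes exactly that part of
    the gain p^(- alpha) and leaves p^(- d). *)
Let y_le : t ^+ 2 <= p -> `|y| <= K1 * (1 + t) ^+ m * p `^ (- d).
Proof.
move=> tp; rewrite /y normrM (ger0_norm lnr_ge0).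
have ad : 0 < alpha - d by rewrite subr_gt0.
apply: (@le_trans _ _ (Lh * ((1 + t) ^+ m * p `^ (- alpha)) *
   (2 * (p `^ (alpha - d) / (alpha - d))))).
  apply: ler_pM => //; first by rewrite (le_trans hH)// ler_pM2l.
  by rewrite (le_trans (lnr_le tp))// ler_wpM2l// ln_le_powR.
have -> : p `^ (- d) = p `^ (- alpha) * p `^ (alpha - d).
  by rewrite -powRD ?(gt_eqF p0) ?implybT//; congr (_ `^ _); ring.
rewrite /K1 le_eqVlt; apply/orP; left; apply/eqP.
by field; rewrite gt_eqF.
Qed.

Let rhx : r `^ (- hx) = r `^ (- H) * expR (- y).
Proof.
rewrite /powR gt_eqF// -expRD; congr expR; rewrite /y; ring.
Qed.

Let rp_le (s : R) : 0 <= s -> r `^ (- s) <= p `^ (- s).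
Proof.
move=> s0; rewrite !powRN lef_pV2 ?posrE ?powR_gt0//.
by rewrite ge0_ler_powR ?nnegrE ?(ltW p0) ?(ltW r0).
Qed.

(** Here ln (r / p) = ln (1 + t^2 / p^2) / 2 <= t^2 / (2 p^2) and 1 - exp(- x) <= x; then d <= 2
    gives p^(- 2) <= p^(- d). *)
Let rp_dist : p `^ (- H) - r `^ (- H) <= H / 2 * t ^+ 2 * p `^ (- (H + d)).
Proof.
have lnrp : ln (r / p) <= t ^+ 2 / p ^+ 2 / 2.
  rewrite ler_pdivlMr// mulr_natr -lnXn ?divr_gt0// expr_div_n rE.
  rewrite mulrDl divff ?expf_neq0 ?gt_eqF// addrC le_ln1Dx//.
  by rewrite (lt_le_trans (ltrN10 _))// divr_ge0 ?sqr_ge0.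
have -> : r `^ (- H) = p `^ (- H) * expR (- (H * ln (r / p))).
  by rewrite /powR !gt_eqF// ln_div// -expRD; congr expR; ring.
have -> : p `^ (- (H + d)) = p `^ (- H) * p `^ (- d).
  by rewrite opprD powRD// (gt_eqF p0) implybT.
rewrite -{1}[p `^ (- H)]mulr1 -mulrBr [leRHS]mulrCA ler_pM2l ?powR_gt0//.
have := expR_ge1Dx (- (H * ln (r / p))).
have pd : p ^- 2 <= p `^ (- d).
  by rewrite -powR_invn ?ler_powR ?lerN2// ltW.
have : H * ln (r / p) <= H * (t ^+ 2 * p `^ (- d) / 2).
  rewrite ler_pM2l// (le_trans lnrp)// ler_pM2r ?invr_gt0//.
  by rewrite ler_wpM2l// sqr_ge0.
have -> : H * (t ^+ 2 * p `^ (- d) / 2) = H / 2 * t ^+ 2 * p `^ (- d) by field.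
move: (expR _) => e; lra.
Qed.

(** The bound e^(- y) <= e^B controls r^(- hx) by r^(- H). The error telescopes into four terms:
    [P1] is the remainder of f, and [P2], [P3], [P4] are the costs of replacing [cx] by [C], [hx] by
    [H] and [r] by [p]. *)
Lemma near_bound : t ^+ 2 <= p ->
  `|fx - C * p `^ (- H)| <=
    (expR B * (1 + Lc + `|C| * K1) + `|C| * (H / 2)) * (1 + t) ^+ (m + 2) *
      p `^ (- (H + d)).
Proof.
move=> tp.
have pHd : p `^ (- (H + d)) = p `^ (- H) * p `^ (- d).
  by rewrite opprD powRD// (gt_eqF p0) implybT.
have yB := y_leB tp.
have eyB : expR (- y) <= expR B.
  by rewrite ler_expR (le_trans _ yB)// -normrN ler_norm.
have rhxB : r `^ (- hx) <= expR B * p `^ (- H).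
  by rewrite rhx mulrC ler_pM ?expR_ge0 ?powR_ge0// rp_le// ltW.
have P1 : `|fx - cx * r `^ (- hx)| <= expR B * p `^ (- (H + d)).
  apply: (le_trans fc); rewrite opprD powRD ?(gt_eqF r0) ?implybT// pHd mulrA.
  by rewrite ler_pM ?powR_ge0// rp_le// ltW.
have P2 : `|(cx - C) * r `^ (- hx)| <=
    Lc * (1 + t) ^+ m * (expR B * p `^ (- (H + d))).
  rewrite normrM (ger0_norm (powR_ge0 _ _)) pHd.
  have -> : Lc * (1 + t) ^+ m * (expR B * (p `^ (- H) * p `^ (- d))) =
    Lc * ((1 + t) ^+ m * p `^ (- d)) * (expR B * p `^ (- H)) by ring.
  apply: ler_pM => //; first exact: powR_ge0.
  apply: (le_trans cC); rewrite ler_pM2l// (le_trans tp_le)//.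
  by rewrite ler_wpM2l ?(le_trans ler01)// ler_powR// lerN2 ltW.
have P3 : `|r `^ (- hx) - r `^ (- H)| <=
    expR B * (K1 * (1 + t) ^+ m * p `^ (- (H + d))).
  rewrite rhx -{2}[r `^ (- H)]mulr1 -mulrBr normrM (ger0_norm (powR_ge0 _ _)).
  have -> : expR B * (K1 * (1 + t) ^+ m * p `^ (- (H + d))) =
    p `^ (- H) * ((K1 * (1 + t) ^+ m * p `^ (- d)) * expR B) by rewrite pHd; ring.
  apply: ler_pM; rewrite ?powR_ge0// ?rp_le ?(ltW H0)//.
  apply: (le_trans (ler_dist_expR1 _)); rewrite normrN.
  by apply: ler_pM; rewrite ?expR_ge0 ?ler_expR ?y_le.
have P4 : `|r `^ (- H) - p `^ (- H)| <= H / 2 * t ^+ 2 * p `^ (- (H + d)).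
  by rewrite distrC ger0_norm ?rp_dist// subr_ge0 rp_le// ltW.
have -> : fx - C * p `^ (- H) = (fx - cx * r `^ (- hx)) +
  (cx - C) * r `^ (- hx) + C * ((r `^ (- hx) - r `^ (- H)) +
  (r `^ (- H) - p `^ (- H))) by ring.
apply: (le_trans (ler_normD _ _)).
have C0 := normr_ge0 C.
have := ler_normD (fx - cx * r `^ (- hx)) ((cx - C) * r `^ (- hx)).
have : `|C * (r `^ (- hx) - r `^ (- H) + (r `^ (- H) - p `^ (- H)))| <=
  `|C| * (expR B * (K1 * (1 + t) ^+ m * p `^ (- (H + d))) +
          H / 2 * t ^+ 2 * p `^ (- (H + d))).
  by rewrite normrM ler_wpM2l// (le_trans (ler_normD _ _))// lerD.
move: P1 P2 => {P3 P4 pHd rhxB}.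
move: `|fx - _| `|(cx - _) * _| `|C * _| `|_ + _| => a b c' e P1 P2 Pc Pe.
have T3 : (1 + t) ^+ m <= (1 + t) ^+ (m + 2).
  by rewrite exprD ler_peMr ?(le_trans ler01)// exprn_ege1// lerDl.
have T4 : t ^+ 2 <= (1 + t) ^+ (m + 2).
  rewrite addnC exprD (@le_trans _ _ ((1 + t) ^+ 2))//.
    by rewrite lerXn2r ?nnegrE ?lerDr ?addr_ge0.
  by rewrite ler_peMr// exprn_ge0// addr_ge0.
have K10 : 0 < K1 by rewrite /K1 !mulr_gt0 ?invr_gt0// subr_gt0.
have E0 := expR_gt0 B.
have W0 := powR_ge0 p (- (H + d)).
move: T1 E0 W0 T3 T4 P1 P2 Pc.
(* Once the powers are abstracted, it remains to use that [U] dominates both [T] = (1 + t)^m and [s]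
   = t^2. *)
move: ((1 + t) ^+ (m + 2)) ((1 + t) ^+ m) (t ^+ 2) (expR B) (p `^ _).
move=> U T s E W T1' E0 W0 T3 T4 P1 P2 Pc.
apply: (@le_trans _ _ (E * W + Lc * T * (E * W) +
    `|C| * (E * (K1 * T * W) + H / 2 * s * W))); first by lra.
have Q1 : E * W <= E * W * U by rewrite ler_peMr ?mulr_ge0 ?(ltW E0)//; lra.
have Q2 : Lc * E * W * T <= Lc * E * W * U.
  by rewrite ler_wpM2l// !mulr_ge0 ?(ltW Lc0) ?(ltW E0).
have Q3 : `|C| * E * K1 * W * T <= `|C| * E * K1 * W * U.
  by rewrite ler_wpM2l// mulr_ge0// mulr_ge0 ?(ltW K10)// mulr_ge0// ltW.
have Q4 : `|C| * (H / 2) * W * s <= `|C| * (H / 2) * W * U.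
  by rewrite ler_wpM2l// !mulr_ge0 ?invr_ge0 ?normr_ge0 ?(ltW H0).
by move: Q1 Q2 Q3 Q4; lra.
Qed.

End pointwise.

(** [K] and [M] are fixed before the point, so the bound can be integrated against the window. The
    two regimes are merged by adding their constants and their exponents. *)
Lemma pointwise_bound (R : realType) (H C Lh Lc alpha d : R) :
  0 < H -> 0 < Lh -> 0 < Lc -> 0 < alpha -> 0 < d -> d < alpha -> d <= 2 ->
  exists (K : R) (M : nat), 0 <= K /\ forall hx cx fx t p r : R,
    2 <= p -> 0 <= t -> 0 < r -> r ^+ 2 = t ^+ 2 + p ^+ 2 -> 0 < hx ->
    `|hx - H| <= Lh * (t / p) `^ alpha ->
    `|cx - C| <= Lc * (t / p) `^ alpha ->
    `|fx - cx * r `^ (- hx)| <= r `^ (- (hx + d)) ->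
    `|fx - C * p `^ (- H)| <= K * p `^ (- (H + d)) * (1 + t) ^+ M.
Proof.
move=> H0 Lh0 Lc0 a0 d0 da d2.
(* One natural number above both [alpha] and H + d, the real exponents to be replaced by integer
   ones. *)
pose m := Num.bound (alpha + (H + d)).
have aHm : alpha + (H + d) < m%:R by apply: archi_boundP; rewrite !addr_ge0 ?ltW.
have am : alpha <= m%:R by rewrite (le_trans _ (ltW aHm))// lerDl addr_ge0 ?ltW.
have Hm : H + d <= m%:R by rewrite (le_trans _ (ltW aHm))// lerDr ltW.
set K1 := 2 * `|C| + Lc + 1.
set K2 := expR (Lh * (4 / alpha)) * (1 + Lc + `|C| * (Lh * 2 / (alpha - d))) +
  `|C| * (H / 2).
have K10 : 0 <= K1 by rewrite !addr_ge0 ?mulr_ge0 ?(ltW Lc0).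
have ad : 0 < alpha - d by rewrite subr_gt0.
have K20 : 0 <= K2.
  rewrite addr_ge0 ?mulr_ge0 ?addr_ge0 ?expR_ge0 ?invr_ge0 ?(ltW H0) ?(ltW Lc0)//.
  by rewrite !mulr_ge0 ?(ltW Lh0) ?invr_ge0 ?(ltW ad).
exists (K1 + K2), (3 * m + (m + 2))%N; split; first exact: addr_ge0.
move=> hx cx fx t p r p2 t0 r0 rE hx0 hH cC fc.
have T1 k : 1 <= (1 + t) ^+ k by rewrite exprn_ege1// lerDl.
rewrite mulrAC exprD; have [tp|tp] := leP (t ^+ 2) p.
  apply: (le_trans (near_bound H0 Lh0 Lc0 a0 d0 da d2 am p2 t0 r0 rE hH cC fc tp)).
  rewrite -/K2 ler_wpM2r ?powR_ge0// ler_pM ?(le_trans ler01 (T1 _))//.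
    by rewrite lerDr.
  by rewrite ler_peMl// (le_trans ler01).
apply: (le_trans (far_bound H0 Lc0 a0 d0 am Hm p2 t0 r0 rE hx0 cC fc tp)).
rewrite -/K1 ler_wpM2r ?powR_ge0// ler_pM ?(le_trans ler01 (T1 _))//.
  by rewrite lerDl.
by rewrite ler_peMr// (le_trans ler01).
Qed.

(** * Geometry of the window and the Radon transform *)

Lemma enorm_ge0 (R : realType) (n : nat) (v : 'rV[R]_n) : 0 <= enorm v.
Proof. exact: sqrtr_ge0. Qed.

Lemma sqr_enorm (R : realType) (n : nat) (v : 'rV[R]_n) :
  enorm v ^+ 2 = \sum_i v ord0 i ^+ 2.
Proof. by rewrite sqr_sqrtr// sumr_ge0// => i _; rewrite sqr_ge0. Qed.

Lemma enormZ (R : realType) (n : nat) (a : R) (v : 'rV[R]_n) :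
  enorm (a *: v) = `|a| * enorm v.
Proof.
rewrite /enorm -sqrtr_sqr -sqrtrM ?sqr_ge0// mulr_sumr.
by congr Num.sqrt; apply: eq_bigr => i _; rewrite mxE exprMn.
Qed.

Lemma enorm0 (R : realType) (n : nat) : enorm (0 : 'rV[R]_n) = 0.
Proof. by rewrite /enorm big1 ?sqrtr0// => i _; rewrite mxE expr0n. Qed.

Lemma enormN (R : realType) (n : nat) (v : 'rV[R]_n) : enorm (- v) = enorm v.
Proof. by rewrite -scaleN1r enormZ normrN1 mul1r. Qed.

Lemma sqr_enorm_point (R : realType) (n : nat) (g : 'rV[R]_n) (p : R) :
  enorm (point g p) ^+ 2 = enorm g ^+ 2 + p ^+ 2.
Proof.
rewrite !sqr_enorm big_split_ord/= big_ord1 row_mxEr mxE; congr (_ + _).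
by apply: eq_bigr => i _; rewrite row_mxEl.
Qed.

Lemma enorm_theta0 (R : realType) (n : nat) : enorm (@theta0 R n) = 1.
Proof.
apply/eqP; rewrite -(@eqrXn2 _ 2) ?enorm_ge0// -[theta0]/(point 0 1).
by rewrite sqr_enorm_point enorm0 expr0n add0r.
Qed.

Lemma lipschitz_sphere_point (R : realType) (n : nat) (alpha : R)
    (g : 'rV[R]_(n + 1) -> R) :
  0 < alpha -> even_fun g -> homogeneous0 g -> lipschitz_sphere alpha g ->
  exists2 L : R, 0 < L & forall gamma p, p != 0 ->
    `|g (point gamma p) - g theta0| <= L * (enorm gamma / `|p|) `^ alpha.
Proof.
move=> a0 eg hg [L L0 gL]; exists L => //.
suff pos gamma p : 0 < p ->
    `|g (point gamma p) - g theta0| <= L * (enorm gamma / p) `^ alpha.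
  move=> gamma p p0; have [pp|pn] := ltP 0 p.
    by rewrite (gtr0_norm pp) pos.
  have np : 0 < - p by rewrite oppr_gt0 lt_neqAle p0.
  rewrite (ler0_norm pn) -eg -[enorm gamma]enormN.
  have -> : - point gamma p = point (- gamma) (- p).
    by rewrite /point opp_row_mx; congr row_mx; apply/rowP => i; rewrite !mxE.
  exact: pos.
move=> p0; set r := enorm (point gamma p).
have rE : r ^+ 2 = enorm gamma ^+ 2 + p ^+ 2 by exact: sqr_enorm_point.
have t0 := enorm_ge0 gamma.
have r0 : 0 < r.
  rewrite lt_neqAle enorm_ge0 andbT eq_sym -sqrf_eq0 rE.
  by rewrite gt_eqF// ltr_wpDl ?sqr_ge0// exprn_gt0.
have pr : p <= r.
  by rewrite -(@ler_pXn2r _ 2) ?nnegrE ?(ltW p0) ?(ltW r0)// rE lerDr sqr_ge0.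
have pN0 : point gamma p != 0.
  apply: contraTneq r0 => xi0; by rewrite /r xi0 enorm0 ltxx.
rewrite -(hg r^-1 (point gamma p)) ?invr_gt0//.
apply: le_trans (gL _ _ _ (enorm_theta0 R n)) _.
  by rewrite /sphere/= enormZ gtr0_norm ?invr_gt0// mulVf// gt_eqF.
rewrite ler_pM2l// ge0_ler_powR ?nnegrE ?enorm_ge0 ?divr_ge0 ?(ltW a0) ?(ltW p0)//.
rewrite -(@ler_pXn2r _ 2) ?nnegrE ?enorm_ge0 ?divr_ge0 ?(ltW p0)//.
have -> : r^-1 *: point gamma p - theta0 = point (r^-1 *: gamma) (r^-1 * p - 1).
  rewrite /point /theta0 scale_row_mx opp_row_mx add_row_mx subr0; congr row_mx.
  by apply/rowP => i; rewrite !mxE.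
rewrite sqr_enorm_point enormZ gtr0_norm ?invr_gt0//.
rewrite expr_div_n ler_pdivlMr ?exprn_gt0//.
(* The squared distance from xi / r to [theta0] is 2 (r - p) / r, while t^2 = (r - p) (r + p). What
   remains is 2 p^2 <= r (r + p), true by p <= r. *)
have -> : ((r^-1 * enorm gamma) ^+ 2 + (r^-1 * p - 1) ^+ 2) * p ^+ 2 =
    2 * (r - p) * p ^+ 2 / r.
  have -> : (r^-1 * enorm gamma) ^+ 2 = r^-1 ^+ 2 * (r ^+ 2 - p ^+ 2).
    by rewrite exprMn rE addrK.
  by field; rewrite gt_eqF.
rewrite ler_pdivrMr//; have -> : enorm gamma ^+ 2 = (r - p) * (r + p).
  by rewrite -subr_sqr rE addrK.
rewrite -[leRHS]mulrA mulrAC mulrC ler_wpM2l ?subr_ge0//.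
by move: p0 pr; clear; nra.
Qed.

(** Decay of [rho] itself (the empty list of derivatives) at order M + 2 n suffices: each of the n
    factors 1 + v_i^2 is at most (1 + |v|)^2. *)
Lemma schwartz_le_prod (R : realType) (n : nat) (rho : 'rV[R]_n -> R) (M : nat) :
  schwartz rho -> exists2 C : R, 0 <= C & forall v,
    (1 + enorm v) ^+ M * `|rho v| <= C * \prod_i (oneDsqr (v ord0 i))^-1.
Proof.
move=> [_ /(_ [::] (M + 2 * n)%N)[C CP]].
have C0 : 0 <= C.
  by apply: le_trans (CP 0); rewrite mulr_ge0// exprn_ge0// addr_ge0// enorm_ge0.
exists C => // v; have e0 := enorm_ge0 v.
have od0 i : 0 < oneDsqr (v ord0 i) by rewrite ltr_pwDl// sqr_ge0.
rewrite prodfV ler_pdivlMr ?prodr_gt0//; apply: le_trans (CP v).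
rewrite exprD -mulrA [_ ^+ (2 * n) * _]mulrC mulrA ler_wpM2l//.
  by rewrite mulr_ge0// exprn_ge0// addr_ge0.
have -> : (1 + enorm v) ^+ (2 * n) = \prod_(i < n) (1 + enorm v) ^+ 2.
  by rewrite prodr_const card_ord exprM.
apply: ler_prod => i _.
rewrite (ltW (od0 _))/=.
have : v ord0 i ^+ 2 <= enorm v ^+ 2.
  by rewrite sqr_enorm (bigD1 i)//= lerDl sumr_ge0// => j _; rewrite sqr_ge0.
rewrite /oneDsqr sqrrD expr1n mul1r -addrA lerD2l => /le_trans; apply.
by rewrite lerDr mulrn_wge0.
Qed.

(** As [rho] has integral 1, [a] is the integral of the integrable function a rho. [I] is chosen
    before [f], [p], [a] and [K], so the estimate is uniform in [p]. *)
Lemma radon_dist_le (R : realType) (n : nat) (rho : 'rV[R]_n -> R) (M : nat) :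
  schwartz rho -> \int[lebesgue_rV R n]_(gamma in setT) rho gamma = 1 ->
  exists2 I : R, 0 <= I & forall (f : 'rV[R]_(n + 1) -> R) (p a K : R), 0 <= K ->
    (forall gamma, `|f (point gamma p) - a| <= K * (1 + enorm gamma) ^+ M) ->
    radon_defined rho f p /\ `|radon rho f p - a| <= K * I.
Proof.
move=> srho rho1; have [C C0 CP] := schwartz_le_prod M srho.
set mu := lebesgue_rV R n in rho1 *.
pose G (v : 'rV[R]_n) := C * \prod_i (oneDsqr (v ord0 i))^-1.
have iG : mu.-integrable setT (EFin \o G) by exact: integrable_prod_oneDsqrV.
have G0 v : 0 <= G v by rewrite mulr_ge0// prod_oneDsqrV_ge0.
have rhoG v : `|rho v| <= G v.
  by apply: le_trans (CP v); rewrite ler_peMl// exprn_ege1// lerDl enorm_ge0.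
have irho : mu.-integrable setT (EFin \o rho).
  apply: le_integrable iG => //.
    apply/measurable_EFinP; apply: continuous_measurable_rV.
    by case: srho => /(_ [::])[].
  by move=> v _ /=; rewrite lee_fin (ger0_norm (G0 v)).
exists (2 * \int[mu]_v G v).
  by rewrite mulr_ge0// Rintegral_ge0// => v _.
move=> f p a K K0 fa.
have iaR : mu.-integrable setT (EFin \o (fun v => a * rho v)).
  by rewrite (_ : _ \o _ = (fun v => a%:E * (rho v)%:E)%E)//; exact: integrableZl.
have iKG : mu.-integrable setT (EFin \o (fun v => K * G v)).
  by rewrite (_ : _ \o _ = (fun v => K%:E * (G v)%:E)%E)//; exact: integrableZl.
have fG v : `|f (point v p) * rho v - a * rho v| <= K * G v.
  rewrite -mulrBl normrM (le_trans (ler_wpM2r (normr_ge0 _) (fa v)))//.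
  by rewrite -mulrA ler_wpM2l.
have [h1 h2] := Rintegral_dist_le iaR iKG fG; split; first exact: h1.
move: h2; rewrite RintegralZl// RintegralZl// rho1 mulr1 mulrCA.
exact.
Qed.

(** * Assembling the asymptotic expansion *)

Theorem proposition2p1 (R : realType) (n : nat)
    (h c : 'rV[R]_(n + 1) -> R) (alpha delta0 : R)
    (f : 'rV[R]_(n + 1) -> R) (rho : 'rV[R]_n -> R) :
  0 < alpha ->
  even_fun h -> even_fun c ->
  homogeneous0 h -> homogeneous0 c ->
  lipschitz_sphere alpha h -> lipschitz_sphere alpha c ->
  (forall xi, xi != 0 -> 0 < h xi) ->
  0 < delta0 ->
  (forall delta : R, 0 < delta < delta0 ->
     (f : _ -> R^o) = (fun xi => c xi / enorm xi `^ h xi)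
       +o_ (at_infty (@enorm R (n + 1)))
         (fun xi => (1 / enorm xi `^ (h xi + delta)) : R^o)) ->
  schwartz rho ->
  \int[lebesgue_rV R n]_(gamma in setT) rho gamma = 1 ->
  (\forall p \near at_infty (fun p : R => `|p|), radon_defined rho f p) /\
  (forall delta : R, 0 < delta < Num.min delta0 alpha -> delta < 2 ->
     (radon rho f : _ -> R^o) =
       (fun p => c theta0 / `|p| `^ h theta0)
       +o_ (at_infty (fun p : R => `|p|))
         (fun p => (1 / `|p| `^ (h theta0 + delta)) : R^o)).
Proof.
move=> a0 eh ec hh hc lh lc h0 delta00 fE srho rho1.
have [Lh Lh0 hL] := lipschitz_sphere_point a0 eh hh lh.
have [Lc Lc0 cL] := lipschitz_sphere_point a0 ec hc lc.
have H0 : 0 < h theta0.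
  by apply/h0/eqP => th0; have := enorm_theta0 R n; rewrite th0 enorm0; lra.
(* A big-O bound at exponent [d]; the little-o at any smaller exponent follows from the spare power
   of |p|. *)
have key d : 0 < d -> d < delta0 -> d < alpha -> d <= 2 ->
    exists K P : R, [/\ 0 <= K, 2 <= P & forall p, P < `|p| ->
      radon_defined rho f p /\
      `|radon rho f p - c theta0 * `|p| `^ (- h theta0)| <=
        K * `|p| `^ (- (h theta0 + d))].
  move=> d0 dd da d2.
  have [K [M [K0 KP]]] := pointwise_bound (c theta0) H0 Lh0 Lc0 a0 d0 da d2.
  have [I I0 IP] := radon_dist_le M srho rho1.
  (* The little-o hypothesis is used with epsilon = 1. The threshold is then raised to 2, as the
     pointwise bound requires. *)
  have /fE/eqaddoP/(_ 1 ltr01)[P _ PP] : 0 < d < delta0 by rewrite d0.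
  exists (K * I), (Num.max 2 P); split; rewrite ?mulr_ge0 ?le_max ?lexx//.
  move=> p; rewrite gt_max => /andP[p2 Pp].
  rewrite mulrAC; apply: IP => [|gamma]; first by rewrite mulr_ge0 ?powR_ge0.
  have t0 := enorm_ge0 gamma; set r := enorm (point gamma p).
  have rE : r ^+ 2 = enorm gamma ^+ 2 + `|p| ^+ 2.
    by rewrite real_normK ?num_real// sqr_enorm_point.
  have pr : `|p| <= r.
    by rewrite -(@ler_pXn2r _ 2) ?nnegrE ?enorm_ge0// rE lerDr sqr_ge0.
  have p0 : 0 < `|p| by rewrite (lt_trans _ p2).
  have pn0 : p != 0 by rewrite -normr_gt0.
  have r0 : 0 < r by rewrite (lt_le_trans p0).
  apply: (KP (h (point gamma p)) (c (point gamma p)) _ _ _ r).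
  - exact: ltW.
  - by [].
  - by [].
  - by [].
  - by apply: h0; apply: contraTneq r0 => xi0; rewrite /r xi0 enorm0 ltxx.
  - exact: hL.
  - exact: cL.
  have := PP (point gamma p) (lt_le_trans Pp pr); rewrite /= !mul1r -/r.
  rewrite !powRN [`|(_ `^ _)^-1|]ger0_norm ?invr_ge0 ?powR_ge0//; exact.
split.
  (* Integrability does not mention delta, so any admissible exponent will do; half the minimum is
     one. *)
  have m0 : 0 < Num.min (Num.min delta0 alpha) 2 by rewrite !lt_min delta00 a0 ltr0n.
  have [|||| K [P [_ _ KP]]] := key (Num.min (Num.min delta0 alpha) 2 / 2).
  - by rewrite divr_gt0.
  - by rewrite ltr_pdivrMr// (le_lt_trans _ (_ : delta0 < _))// ?ge_min ?lexx//; lra.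
  - rewrite ltr_pdivrMr//.
    by rewrite (le_lt_trans _ (_ : alpha < _))// ?ge_min ?lexx ?orbT//; lra.
  - by rewrite ler_pdivrMr// (le_trans (_ : _ <= 2))// ?ge_min ?lexx ?orbT//; lra.
  by exists P => // p /KP[].
move=> d /andP[d0]; rewrite lt_min => /andP[dd da] d2.
pose m := Num.min (Num.min delta0 alpha) 2.
have dm : d < m by rewrite !lt_min dd da.
have [m1 m2 m3] : [/\ m <= delta0, m <= alpha & m <= 2].
  by rewrite /m !ge_min !lexx ?orbT.
(* An exponent strictly between [d] and [m], which leaves a factor |p|^(- (d' - d)) tending to 0. *)
pose d' := (d + m) / 2.
have dd' : d < d' by rewrite /d' midf_lt.
have d'm : d' < m by rewrite /d' midf_lt.
have [|||| K [P [K0 P2 KP]]] := key d'.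
- exact: lt_trans dd'.
- exact: lt_le_trans m1.
- exact: lt_le_trans m2.
- exact: le_trans (ltW d'm) m3.
apply/eqaddoP => e /= e0.
(* Beyond the second threshold, K |p|^(- (d' - d)) <= e. *)
exists (Num.max P ((K / e) `^ (d' - d)^-1)) => // p /=.
rewrite gt_max => /andP[Pp Kp].
have [_ KPp] := KP _ Pp.
have p0 : 0 < `|p| by rewrite (le_lt_trans _ Pp)// (le_trans _ P2).
rewrite mul1r -powRN (ger0_norm (powR_ge0 _ _)).
rewrite [X in `|X| <= _](_ : _ = radon rho f p - c theta0 * `|p| `^ (- h theta0));
  last by rewrite powRN.
apply: (le_trans KPp).
have -> : - (h theta0 + d') = - (h theta0 + d) + - (d' - d) by ring.
rewrite powRD ?(gt_eqF p0) ?implybT// mulrCA mulrC ler_pM2r ?powR_gt0//.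
rewrite powRN ler_pdivrMr ?powR_gt0// mulrC -ler_pdivrMr//.
have d'd : 0 < d' - d by rewrite subr_gt0.
have -> : K / e = ((K / e) `^ (d' - d)^-1) `^ (d' - d).
  by rewrite -powRrM mulVf ?gt_eqF// powRr1// divr_ge0// ltW.
by rewrite ge0_ler_powR ?nnegrE ?powR_ge0// ltW.
Qed.
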